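(* Let $\mu>0$, $\beta>0$, and let $z(t)=(x(t),y(t))$, $t\ge0$, be a solution of the flow $$x'=y-x-\beta\nabla\phi^*(\nabla f(x)),\qquad \bigl(\nabla\phi(y)\bigr)'=\nabla\phi(x)-\nabla\phi(y)-\tfrac1\mu\nabla f(x).$$ Let $E(z)=D_f(x,x^\star)+\mu D_\phi(x^\star,y)$ for $z=(x,y)$. Then along the flow $$\frac{d}{dt}E(z)=\langle\nabla E(z),z'\rangle=-E(z)-\beta\langle\nabla f(x),\nabla\phi^*(\nabla f(x))\rangle-D_{f-\mu\phi}(x^\star,x)-\mu D_\phi(y,x).$$ Consequently, if $f-\mu\phi$ is convex, then $$E(z(t))\le e^{-t}E(z(0)),\qquad t\ge0.$$
   Context: $V$ is a finite-dimensional Hilbert space with dual $V^*$ and pairing $\langle\cdot,\cdot\rangle$. $f\in C^1(V)$, and $x^\star$ is a minimizer of $f$ (so $\nabla f(x^\star)=0$). The mirror function $\phi$ is Legendre: closed, proper, strictly convex, differentiable on $\operatorname{int}\operatorname{dom}\phi$, with $\nabla\phi$ one-to-one from $\operatorname{int}\operatorname{dom}\phi$ onto $\operatorname{int}\operatorname{dom}\phi^*$, where $\phi^*$ is the Fenchel conjugate; thus $(\nabla\phi)^{-1}=\nabla\phi^*$. It is assumed throughout that $\nabla\phi(0)=0$ and $\nabla\phi^*(0)=0$. All points at which $\nabla\phi$, $\nabla\phi^*$ are evaluated lie in $\operatorname{int}\operatorname{dom}\phi$, $\operatorname{int}\operatorname{dom}\phi^*$ respectively, and $x^\star\in\operatorname{int}\operatorname{dom}\phi$.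 The Bregman divergence of a differentiable function $h$ is $D_h(u,v)=h(u)-h(v)-\langle\nabla h(v),u-v\rangle$. The pairing $\langle\nabla E(z),z'\rangle$ is computed in the coordinates $(x,\eta)$ with $\eta=\nabla\phi(y)$, i.e. it is the time derivative of $E$ along the flow; a solution means that $t\mapsto x(t)$ and $t\mapsto\nabla\phi(y(t))$ are differentiable and satisfy the equations. *)

(* Defs.v *)
From HB Require Import structures.
From mathcomp Require Import all_boot all_order all_algebra.
From mathcomp Require Import all_classical all_reals all_analysis.

Set Implicit Arguments.
Unset Strict Implicit.
Unset Printing Implicit Defensive.

Import Order.TTheory GRing.Theory Num.Theory.
Import numFieldNormedType.Exports.

Local Open Scope classical_set_scope.
Local Open Scope ring_scope.

(* Real finite-dimensional Hilbert spaces: completeness is automatic. *)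
HB.mixin Record NormedVector_isHilbert (R : realType) V
    & NormedModule R V & Vector R V := {
  inner : {dot V for idfun} ;
  normrE_inner : forall v : V, `|v| ^+ 2 = inner v v
}.

#[short(type="finHilbertType")]
HB.structure Definition FinHilbert (R : realType) :=
  {V of NormedModule R V & Vector R V & NormedVector_isHilbert R V}.

(* In finite dimension every linear functional is continuous, so the
   topological dual is the space of all linear functionals. *)
Definition dual (R : realType) (V : finHilbertType R) : Type := 'Hom(V, R^o).

HB.instance Definition _ (R : realType) (V : finHilbertType R) :=
  Vector.on (dual V).

Definition pairing (R : realType) (V : finHilbertType R) (l : dual V) (v : V)
  : R := fun_of_lfun l v.

Section dual_norm.
Context {R : realType} {V : finHilbertType R}.
Implicit Types (u v w : V) (l : dual V).

Lemma inner_is_linear u : linear (inner u : V -> R^o).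
Proof. by move=> a v w; rewrite linearPr. Qed.

Definition flat u : dual V :=
  linfun (HB.pack_for {linear V -> R^o} (inner u : V -> R^o)
    (GRing.isLinear.Build R V R^o *:%R _ (inner_is_linear u))).

Lemma flatE u v : pairing (flat u) v = inner u v.
Proof. by rewrite /pairing /flat lfunE. Qed.

Lemma flat_is_linear : linear flat.
Proof.
move=> a u w; apply/lfunP => v.
rewrite add_lfunE scale_lfunE -![fun_of_lfun _ _]/(pairing _ _).
by rewrite !flatE linearPl.
Qed.

Let flat_hom : 'Hom(V, dual V) :=
  linfun (HB.pack_for {linear V -> dual V} flat
    (GRing.isLinear.Build R V (dual V) *:%R _ flat_is_linear)).

Let flat_homE u : flat_hom u = flat u. Proof. by rewrite /flat_hom lfunE. Qed.

Let lker_flat : lker flat_hom == 0%VS.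
Proof.
apply/lker0P => u v; rewrite !flat_homE => uv.
apply/eqP; rewrite -subr_eq0 -normr_eq0 -sqrf_eq0.
by rewrite normrE_inner linearBl /= -!flatE uv subrr.
Qed.

(* The Riesz isomorphism: the inverse of u |-> <u, .>. *)
Definition riesz : dual V -> V := flat_hom^-1%VF.

Lemma riesz_is_linear : linear riesz.
Proof. by move=> a l m; rewrite /riesz linearP. Qed.

HB.instance Definition _ :=
  GRing.isLinear.Build R (dual V) V *:%R riesz riesz_is_linear.

Lemma flatK : cancel flat riesz.
Proof. by move=> u; rewrite -flat_homE; apply: lker0_lfunK. Qed.

Lemma rieszK : cancel riesz flat.
Proof.
move=> l; rewrite -flat_homE limg_lfunVK//.
suff -> : limg flat_hom = fullv by exact: memvf.
apply/eqP; rewrite eqEdim subvf limg_dim_eq ?(eqP lker_flat) ?capv0//=.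
by rewrite !dimvf /dim /= muln1.
Qed.

Lemma inner_riesz l v : inner (riesz l) v = pairing l v.
Proof. by rewrite -flatE rieszK. Qed.

Definition dual_norm l : R := `|riesz l|.

Lemma dual_normD l m : dual_norm (l + m) <= dual_norm l + dual_norm m.
Proof. by rewrite /dual_norm linearD ler_normD. Qed.

Lemma dual_normZ (a : R) l : dual_norm (a *: l) = `|a| * dual_norm l.
Proof. by rewrite /dual_norm linearZ normrZ. Qed.

Lemma dual_norm_eq0 l : dual_norm l = 0 -> l = 0.
Proof.
move/normr0_eq0 => l0; apply: (can_inj rieszK).
by rewrite l0 linear0.
Qed.

End dual_norm.

HB.instance Definition _ (R : realType) (V : finHilbertType R) :=
  Lmodule_isNormed.Build R (dual V)
    (@dual_normD R V) (@dual_normZ R V) (@dual_norm_eq0 R V).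
Section gradients.
Context {R : realType} {V : finHilbertType R}.

Definition grad (h : V -> R) (v : V) : dual V := linfun ('d h v).

Lemma gradE (h : V -> R) u v : pairing (grad h v) u = 'd h v u.
Proof. by rewrite /pairing /grad lfunE. Qed.

(* Gradient of a function on the dual, seen in V through V = V^**. *)
Definition dual_grad (h : dual V -> R) (l : dual V) : V :=
  get [set v | forall m, 'd h l m = pairing m v].

Lemma dual_gradE (h : dual V -> R) l m : pairing m (dual_grad h l) = 'd h l m.
Proof.
suff : exists v, forall m, 'd h l m = pairing m v.
  by move=> /(@getPex _ [set v | _]) ->.
pose L u : R^o := 'd h l (flat u).
have Llin : linear L by move=> a u v; rewrite /L flat_is_linear linearP.
pose F : dual V := linfun (HB.pack_for {linear V -> R^o} L
  (GRing.isLinear.Build R V R^o *:%R _ Llin)).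
exists (riesz F) => {}m.
rewrite -[m in LHS]rieszK -[m in RHS]rieszK flatE -[LHS]/(L _).
by rewrite hermC /= expr0 mul1r inner_riesz /pairing lfunE.
Qed.

Definition bregman (h : V -> R) (u v : V) : R :=
  h u - h v - pairing (grad h v) (u - v).

End gradients.

Section legendre.
Context {R : realType} {V : finHilbertType R}.
Implicit Types phi : V -> \bar R.

Definition edom (T : Type) (g : T -> \bar R) : set T := [set v | (g v < +oo)%E].

Definition proper phi := (forall v, phi v != -oo%E) /\ edom phi !=set0.

Definition strictly_convex phi :=
  forall (u v : V) (t : R), edom phi u -> edom phi v -> u != v ->
    0 < t -> t < 1 ->
    (phi (t *: u + (1 - t) *: v)%R < t%:E * phi u + (1 - t)%:E * phi v)%E.

Definition conjugate phi (l : dual V) : \bar R :=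
  ereal_sup (range (fun v => (pairing l v)%:E - phi v)%E).

Definition mirror phi : V -> dual V := grad (fine \o phi).

Definition dual_mirror phi : dual V -> V := dual_grad (fine \o conjugate phi).

Definition legendre phi :=
  [/\ proper phi, lower_semicontinuous phi, strictly_convex phi,
      (forall v, (edom phi)° v -> differentiable (fine \o phi) v)
    & set_bij (edom phi)° (edom (conjugate phi))° (mirror phi)].

End legendre.

(* Derivative at t of a curve defined on the half-line [0, +oo[: two-sided if
   0 < t and right-sided if t = 0. *)
Section half_line.
Context {R : realType} {W : normedModType R}.

Definition diff_quotient (u : R -> W) (t s : R) : W := (s - t)^-1 *: (u s - u t).

Definition half_line_derivable (u : R -> W) (t : R) :=
  cvg (diff_quotient u t s @[s --> within `[0, +oo[ t^']).

Definition half_line_derive (u : R -> W) (t : R) : W :=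
  lim (diff_quotient u t s @[s --> within `[0, +oo[ t^']).

End half_line.

Section flow.
Context {R : realType} {V : finHilbertType R}.
Variables (f : V -> R) (phi : V -> \bar R) (mu beta : R) (xstar : V).

Definition flow_solution (x y : R -> V) :=
  forall t, 0 <= t ->
  [/\ [/\ (edom phi)° (x t), (edom phi)° (y t)
        & (edom (conjugate phi))° (grad f (x t))],
      half_line_derivable x t,
      half_line_derive x t =
        y t - x t - beta *: dual_mirror phi (grad f (x t)),
      half_line_derivable (mirror phi \o y) t
    & half_line_derive (mirror phi \o y) t =
        mirror phi (x t) - mirror phi (y t) - mu^-1 *: grad f (x t)].

Definition energy (z : V * V) : R :=
  bregman f z.1 xstar + mu * bregman (fine \o phi) xstar z.2.

(* The energy in the coordinates (x, eta), where y = grad phi^* (eta). *)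
Definition energy_coord (p : V * dual V) : R :=
  energy (p.1, dual_mirror phi p.2).

End flow.

(* Main.v *)
From HB Require Import structures.
Require Import Defs.
From mathcomp Require Import all_boot all_order all_algebra.
From mathcomp Require Import all_classical all_reals all_analysis.
From mathcomp Require Import ring lra.

Set Implicit Arguments.
Unset Strict Implicit.
Unset Printing Implicit Defensive.

Import Order.TTheory GRing.Theory Num.Theory.
Import numFieldNormedType.Exports.

Local Open Scope classical_set_scope.
Local Open Scope ring_scope.

(* By Fenchel's equality the energy in the coordinates (x, eta) is
   f x - f xstar + mu (phi xstar + phi^* eta - <eta, xstar>), so everything
   rests on the differentiability of phi^* at eta = grad phi (v), with gradient
   v. This is obtained directly, without biconjugation: strict convexity and
   compactness of a small sphere around v give
   phi u - phi v - <eta, u - v> >= d |u - v| away from v, so for |m| <= d the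
   supremum defining phi^* (eta + m) is governed by the points u close to v,
   and phi^* (eta + m) - phi^* eta - <m, v> lies in [0, e |m|]. The formula for
   the derivative of E is then the chain rule. When f - mu phi is convex, every
   term of it besides - E is nonpositive, since
   <grad f x, grad phi^* (grad f x)> >= 0 by monotonicity of grad phi and
   grad phi 0 = 0; hence exp(t) E(t) is nonincreasing. *)

(** * Differentials from epsilon estimates *)

Section differentials.
Context {R : realType} {U W : normedModType R}.

Lemma diff_from_bound (F : U -> W) (L : {linear U -> W}) (x : U) :
  continuous L ->
  (forall e, 0 < e -> \forall h \near 0, `|F (h + x) - F x - L h| <= e * `|h|) ->
  differentiable F x /\ 'd F x = L :> (U -> W).
Proof.
move=> Lc FL.
have FxL : F \o shift x = cst (F x) + L +o_ 0 id.
  apply/eqaddoP => e e0; near=> h.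
  rewrite -[(_ - _) h]/(F (h + x) - (F x + L h)) opprD addrA.
  by near: h; exact: FL.
have dFL := diff_unique Lc FxL.
by split=> //; apply/diff_locallyP; rewrite dFL.
Unshelve. all: by end_near. Qed.

(** Differentiability is local. This is needed because the closed form of the energy in (x, eta) is
    available only for eta in an open set. *)
Lemma near_diff (F G : U -> W) (x : U) :
  (\forall z \near x, F z = G z) -> differentiable G x ->
  differentiable F x /\ 'd F x = 'd G x :> (U -> W).
Proof.
move=> FG dG; apply: diff_from_bound; first exact: diff_continuous.
move=> e e0; have /diff_locally/eqaddoP/(_ e e0) := dG.
have := nbhs_singleton FG; move: FG; rewrite (near_shift 0) subr0 => FG FGx.
apply: filterS2 FG => h /= -> .
rewrite -[((_ - _) : U -> W) h]/(G (h + x) - (G x + 'd G x h)).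
by rewrite FGx opprD addrA.
Qed.

Lemma diff_bound (F : U -> W) (x : U) e : differentiable F x -> 0 < e ->
  \forall h \near 0, `|F (h + x) - F x - 'd F x h| <= e * `|h|.
Proof.
move=> dF e0; have /diff_locally/eqaddoP/(_ e e0) := dF.
apply: filterS => h.
rewrite -[((_ - _) : U -> W) h]/(F (h + x) - (F x + 'd F x h)).
by rewrite opprD addrA.
Qed.

End differentials.

(** * Bilinearity and continuity of the pairing *)

Section dual_pairing.
Context {R : realType} {V : finHilbertType R}.
Implicit Types (l m : dual V) (u v : V).

Lemma pairing0 l : pairing l 0 = 0. Proof. exact: linear0. Qed.
Lemma pairingD l u v : pairing l (u + v) = pairing l u + pairing l v.
Proof. exact: linearD. Qed.
Lemma pairingN l u : pairing l (- u) = - pairing l u.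
Proof. exact: linearN. Qed.
Lemma pairingZ l a u : pairing l (a *: u) = a * pairing l u.
Proof. exact: linearZ. Qed.
Lemma pairing0l v : pairing (0 : dual V) v = 0.
Proof. by rewrite /pairing zero_lfunE. Qed.
Lemma pairingDl l m v : pairing (l + m) v = pairing l v + pairing m v.
Proof. by rewrite /pairing add_lfunE. Qed.
Lemma pairingZl a m v : pairing (a *: m) v = a * pairing m v.
Proof. by rewrite /pairing scale_lfunE. Qed.
Lemma pairingNl m v : pairing (- m) v = - pairing m v.
Proof. by rewrite /pairing opp_lfunE. Qed.

(** Cauchy-Schwarz, obtained by squaring the triangle inequality for [u + v] and expanding. *)
Lemma inner_le u v : inner u v <= `|u| * `|v|.
Proof.
have : `|u + v| ^+ 2 <= (`|u| + `|v|) ^+ 2.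
  by rewrite ler_sqr ?nnegrE ?addr_ge0// ler_normD.
rewrite normrE_inner linearDl /= !linearDr /= -!normrE_inner.
rewrite [inner v u]hermC /= expr0 mul1r; lra.
Qed.

Lemma pairing_le l v : pairing l v <= `|l| * `|v|.
Proof. by rewrite -inner_riesz; exact: inner_le. Qed.

Lemma pairing_norm_le l v : `|pairing l v| <= `|l| * `|v|.
Proof.
by rewrite ler_norml pairing_le andbT lerNl -pairingN -(normrN v) pairing_le.
Qed.

(** Testing against the functional [flat (u - v)] gives |u - v|^2 = 0. *)
Lemma pairing_inj u v : (forall m, pairing m u = pairing m v) -> u = v.
Proof.
move=> uv; apply/eqP; rewrite -subr_eq0 -normr_eq0 -sqrf_eq0 normrE_inner.
by rewrite -flatE pairingD pairingN uv subrr.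
Qed.

Lemma evaluation_is_linear v : linear ((fun l => pairing l v) : dual V -> R^o).
Proof. by move=> a l m; rewrite pairingDl pairingZl. Qed.

(** The canonical map from V to its bidual, bundled as a linear map so that it can be the
    differential of a function on the dual. *)
Definition evaluation v : {linear dual V -> R^o} :=
  HB.pack_for {linear dual V -> R^o} ((fun l => pairing l v) : dual V -> R^o)
    (GRing.isLinear.Build R (dual V) R^o *:%R _ (evaluation_is_linear v)).

Lemma evaluation_continuous v : continuous (evaluation v : dual V -> R).
Proof.
apply: bounded_linear_continuous; apply/ex_bound.
exists `|v|; near=> l => /=.
by rewrite (le_trans (pairing_norm_le _ _))// ler_piMl.
Unshelve. all: by end_near. Qed.

End dual_pairing.

(** * Convexity, Bregman divergences and Fenchel's equality *)

Section convexity.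
Context {R : realType} {V : finHilbertType R}.
Implicit Types (h : V -> R) (phi : V -> \bar R) (u v : V).

(** Convexity bounds the difference quotients at [v] towards [u] by [h u - h v]; let t decrease to
    0. Only the segment from [v] to [u] matters, so the lemma applies to functions that are convex
    merely on a domain. *)
Lemma bregman_ge0 h u v : differentiable h v ->
  (forall t, 0 < t -> t < 1 ->
    h (t *: u + (1 - t) *: v) <= t * h u + (1 - t) * h v) ->
  0 <= bregman h u v.
Proof.
move=> dh hconv; rewrite /bregman gradE subr_ge0 -deriveE//.
have der : (fun t : R => t^-1 *: ((h \o shift v) (t *: (u - v)) - h v)) @ 0^'+ -->
    'D_(u - v) h v.
  by apply: cvg_dnbhs_at_right; exact: diff_derivable.
apply: (@closed_cvg R R _ _ _ (fun x => x <= h u - h v) _ _ _ der).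
  exact: closed_le.
near=> t => /=.
have t0 : 0 < t by near: t; exact: nbhs_right_gt.
have t1 : t < 1 by near: t; exact: nbhs_right_lt.
rewrite /GRing.scale/= mulrC ler_pdivrMr//.
have := hconv t t0 t1.
have -> : t *: u + (1 - t) *: v = t *: (u - v) + v.
  by rewrite scalerBr scalerBl scale1r [v - _]addrC addrA.
lra.
Unshelve. all: by end_near. Qed.

Lemma edom_fineK phi u : Defs.proper phi -> edom phi u -> (fine (phi u))%:E = phi u.
Proof.
move=> [phiN _] phiu; rewrite fineK// fin_numE phiN/=.
by move: phiu; rewrite /edom/= lt_neqAle => /andP[].
Qed.

Lemma strictly_convex_fine phi u v t : Defs.proper phi -> strictly_convex phi ->
  edom phi u -> edom phi v -> u != v -> 0 < t -> t < 1 ->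
  edom phi (t *: u + (1 - t) *: v) /\
  fine (phi (t *: u + (1 - t) *: v)) < t * fine (phi u) + (1 - t) * fine (phi v).
Proof.
move=> pphi cphi phiu phiv uv t0 t1.
have := cphi u v t phiu phiv uv t0 t1.
rewrite -(edom_fineK pphi phiu) -(edom_fineK pphi phiv) -!EFinM -EFinD => lt_phi.
have phiw : edom phi (t *: u + (1 - t) *: v) by rewrite /edom/= (lt_le_trans lt_phi) ?leey.
by split=> //; move: lt_phi; rewrite -(edom_fineK pphi phiw) lte_fin.
Qed.

Lemma convex_fine phi u v t : Defs.proper phi -> strictly_convex phi ->
  edom phi u -> edom phi v -> 0 < t -> t < 1 ->
  edom phi (t *: u + (1 - t) *: v) /\
  fine (phi (t *: u + (1 - t) *: v)) <= t * fine (phi u) + (1 - t) * fine (phi v).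
Proof.
move=> pphi cphi phiu phiv t0 t1; have [<-|uv] := eqVneq u v.
  by rewrite -scalerDl -mulrDl addrC subrK scale1r mul1r.
by have [? /ltW] := strictly_convex_fine pphi cphi phiu phiv uv t0 t1.
Qed.

Section mirror_function.
Variable phi : V -> \bar R.
Hypothesis phi_proper : Defs.proper phi.
Hypothesis phi_convex : strictly_convex phi.
Hypothesis phi_diff : forall v, (edom phi)° v -> differentiable (fine \o phi) v.

Local Notation h := (fine \o phi).

Lemma mirror_bregman_ge0 u v : edom phi u -> (edom phi)° v -> 0 <= bregman h u v.
Proof.
move=> phiu phiv; apply: bregman_ge0; first exact: phi_diff.
move=> t t0 t1; have phiv' := interior_subset phiv.
by have [] := convex_fine phi_proper phi_convex phiu phiv' t0 t1.
Qed.

(** The divergence differs from [F] by an affine function and vanishes at [v], so it inherits the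
    convexity inequality without its second term. *)
Lemma bregmanZ (F : V -> R) u v t :
  F (t *: u + (1 - t) *: v) <= t * F u + (1 - t) * F v ->
  bregman F (t *: u + (1 - t) *: v) v <= t * bregman F u v.
Proof.
move=> Fle; rewrite /bregman.
have -> : t *: u + (1 - t) *: v - v = t *: (u - v).
  by rewrite scalerBl scale1r addrA addrAC addrK scalerBr.
rewrite pairingZ; lra.
Qed.

(** At the midpoint w of [u] and [v], strict convexity gives D(w, v) < D(u, v) / 2, while D(w, v) is
    nonnegative. *)
Lemma mirror_bregman_gt0 u v : edom phi u -> (edom phi)° v -> u != v ->
  0 < bregman h u v.
Proof.
move=> phiu phiv uv; have phiv' := interior_subset phiv.
have t0 : (0 : R) < 2^-1 by rewrite invr_gt0.
have t1 : (2^-1 : R) < 1 by rewrite invf_lt1// ltr1n.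
have [phiw lt_phi] := strictly_convex_fine phi_proper phi_convex phiu phiv' uv t0 t1.
have := mirror_bregman_ge0 phiw phiv; rewrite /bregman.
have -> : 2^-1 *: u + (1 - 2^-1) *: v - v = 2^-1 *: (u - v).
  by rewrite scalerBl scale1r addrA addrAC addrK scalerBr.
rewrite pairingZ/=; move: lt_phi; lra.
Qed.

(** The pairing equals D(u, v) + D(v, u). *)
Lemma mirror_monotone u v : (edom phi)° u -> (edom phi)° v ->
  0 <= pairing (mirror phi u - mirror phi v) (u - v).
Proof.
move=> phiu phiv.
have := mirror_bregman_ge0 (interior_subset phiu) phiv.
have := mirror_bregman_ge0 (interior_subset phiv) phiu.
rewrite /bregman /mirror pairingDl pairingNl -(opprB u v) pairingN; lra.
Qed.

(** Recentres at [v] the expression whose supremum over [u] is the conjugate. For [l = mirror phi v]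
    only the divergence depends on [u]; for nearby [l] it competes with a small linear term. *)
Lemma conjugate_bregman (l : dual V) v u : edom phi u -> (edom phi)° v ->
  ((pairing l u)%:E - phi u = (pairing (mirror phi v) v - h v
    + pairing (l - mirror phi v) u - bregman h u v)%:E)%E.
Proof.
move=> phiu phiv; rewrite -(edom_fineK phi_proper phiu) -EFinB; congr EFin.
rewrite /bregman /mirror pairingDl pairingNl pairingD pairingN/=; lra.
Qed.

Lemma conjugate_mirror v : (edom phi)° v ->
  conjugate phi (mirror phi v) = (pairing (mirror phi v) v - h v)%:E.
Proof.
move=> phiv; apply/eqP; rewrite eq_le; apply/andP; split.
  apply: ge_ereal_sup => _ [u _ <-].
  (* Points outside the domain contribute -oo to the supremum. *)
  have [phiu|] := ltP (phi u) +oo%E; last first.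
    by rewrite leye_eq => /eqP ->; rewrite addeC/= leNye.
  rewrite (conjugate_bregman _ phiu phiv) lee_fin subrr pairing0l addr0.
  by rewrite gerBl mirror_bregman_ge0.
apply: ereal_sup_ubound; exists v => //.
by rewrite -[in LHS](edom_fineK phi_proper (interior_subset phiv)).
Qed.

End mirror_function.
End convexity.

(** * Compactness of spheres in finite dimension *)

Section finite_dimension.
Context {R : realType} {V : finHilbertType R}.
Let n := \dim {:V}.
Let b := vbasis {:V}.

Let combination (w : 'rV[R]_n) : V := \sum_(i < n) w 0 i *: b`_i.

Let combinationZ a w : combination (a *: w) = a *: combination w.
Proof.
by rewrite /combination scaler_sumr; apply: eq_bigr => i _; rewrite mxE scalerA.
Qed.

Let combination_continuous : continuous combination.
Proof.
apply: continuous_big => [|i _ w].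
  exact: add_continuous.
apply: (@cvgZr_tmp R V _ (nbhs w)).
exact: coord_continuous.
Qed.

Let combination_surj v : exists w, combination w = v.
Proof.
exists (\row_i coord b i v); rewrite [RHS](coord_vbasis (memvf v)).
by apply: eq_bigr => i _; rewrite mxE.
Qed.

Let combination_eq0 w : combination w = 0 -> w = 0.
Proof.
move=> w0; apply/rowP => i; rewrite mxE.
rewrite -[LHS](coord_sum_free (fun i => w 0 i) i (basis_free (vbasisP {:V}))).
by rewrite -/b -/(combination w) w0 linear0.
Qed.

Lemma closed_norm_eq (W : normedModType R) (r : R) : closed [set w : W | `|w| = r].
Proof.
rewrite -[X in closed X]/(Num.norm @^-1` [set r]).
by apply: preimage_closed; [move=> ? _; exact: norm_continuous|exact: closed_eq].
Qed.

Let compact_row_sphere r : compact [set w : 'rV[R]_n | `|w| = r].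
Proof.
apply: bounded_closed_compact; last exact: closed_norm_eq.
by exists r; split=> [|x rx w /= ->]; [exact: num_real|exact: ltW].
Qed.

(** The constant is the minimum of |[combination]| on the compact unit sphere of coordinates,
    positive because the basis is free; homogeneity does the rest. *)
Let combination_norm_ge : exists2 c : R, 0 < c & forall w, c * `|w| <= `|combination w|.
Proof.
have [S0|S0] := pselect ([set w : 'rV[R]_n | `|w| = 1] !=set0); last first.
  (* With an empty unit sphere the only coordinate vector is 0, and any positive constant works. *)
  exists 1 => // w; have [->|w0] := eqVneq w 0; first by rewrite normr0 mulr0.
  case: S0; exists (`|w|^-1 *: w) => /=.
  by rewrite normrZ normfV normr_id mulVf// normr_eq0.
have [|w0] := compact_EVT_min (f := Num.norm \o combination) S0 (@compact_row_sphere 1).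
  apply: continuous_subspaceT => w; apply: continuous_comp.
    exact: combination_continuous.
  exact: norm_continuous.
rewrite inE/= => w01 minw0; exists `|combination w0|.
  rewrite normr_gt0; apply/eqP => /combination_eq0 w00.
  by move: w01; rewrite w00 normr0 => /eqP; rewrite eq_sym oner_eq0.
move=> w; have [->|w_neq0] := eqVneq w 0; first by rewrite normr0 mulr0.
have Nw : 0 < `|w| by rewrite normr_gt0.
have := minw0 (`|w|^-1 *: w); rewrite inE/= combinationZ !normrZ normfV normr_id.
rewrite mulVf ?gt_eqF// => /(_ erefl).
by rewrite -(ler_pM2l Nw) mulrA divff ?gt_eqF// mul1r mulrC.
Qed.

(** The sphere is the continuous image of its set of coordinates, which is closed by continuity and
    bounded by r / c thanks to [combination_norm_ge]. *)
Lemma compact_sphere r : compact [set v : V | `|v| = r].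
Proof.
have -> : [set v : V | `|v| = r] = combination @` [set w | `|combination w| = r].
  apply/seteqP; split=> [v /= vr|_ [w wr <-]//].
  by have [w wv] := combination_surj v; exists w; rewrite //= wv.
apply: continuous_compact.
  by apply: continuous_subspaceT; exact: combination_continuous.
apply: bounded_closed_compact; last first.
  rewrite -[X in closed X]/(combination @^-1` [set v | `|v| = r]).
  by apply: preimage_closed => [? _|]; [exact: combination_continuous|exact: closed_norm_eq].
have [c c0 cle] := combination_norm_ge.
exists (r / c); split; first exact: num_real.
move=> x rx w /= wr; apply: le_trans (ltW rx).
by rewrite ler_pdivlMr// mulrC -wr.
Qed.

End finite_dimension.

(** * Differentiability of the conjugate at mirror points *)

Section conjugate_gradient.
Context {R : realType} {V : finHilbertType R}.
Variable phi : V -> \bar R.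
Hypothesis phi_proper : Defs.proper phi.
Hypothesis phi_convex : strictly_convex phi.
Hypothesis phi_diff : forall v, (edom phi)° v -> differentiable (fine \o phi) v.

Local Notation h := (fine \o phi).

Lemma mirror_bregman_growth v (e : R) : (edom phi)° v -> 0 < e ->
  exists2 d : R, 0 < d &
    forall u, edom phi u -> e <= `|u - v| -> d * `|u - v| <= bregman h u v.
Proof.
(* Shrinking [e] strengthens the conclusion, so the sphere may be assumed to lie in the interior of
   the domain, where [phi] is continuous. *)
move=> phiv; wlog [phie e0] : e / (forall u, `|u - v| = e -> (edom phi)° u) /\ 0 < e.
  move=> hwlog e0.
  have /nbhs_ballP[r /= r0 vr] : nbhs v (edom phi)° by exact: nbhs_interior.
  have m0 : 0 < Num.min e (r / 2) by rewrite lt_min e0 divr_gt0.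
  have [|//|d d0 dle] := hwlog (Num.min e (r / 2)).
    split=> // u uv; apply: vr; rewrite -ball_normE/= distrC uv.
    by rewrite gt_min; apply/orP; right; lra.
  by exists d => // u phiu eu; apply: dle; rewrite // ge_min eu.
move=> _; have [S0|S0] := pselect ([set w : V | `|w| = e] !=set0); last first.
  (* If the sphere is empty, no [u] is at distance at least [e] from [v]: rescaling [u - v] would
     give a point of the sphere. *)
  exists 1 => // u _ eu; case: S0; exists ((e / `|u - v|) *: (u - v)) => /=.
  have uv0 : 0 < `|u - v| by exact: lt_le_trans eu.
  by rewrite normrZ ger0_norm ?divr_ge0// ?ltW// divfK// gt_eqF.
have bregman_cont w : `|w| = e -> {for w, continuous (fun w => bregman h (v + w) v)}.
  move=> we; have phivw : (edom phi)° (v + w) by apply: phie; rewrite addrAC subrr add0r.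
  rewrite (_ : (fun _ => _) = fun w => h (v + w) - h v - 'd h v w); last first.
    by apply/funext => w'; rewrite /bregman gradE [in 'd _ _ _]addrC addKr.
  apply: cvgB; last exact: (diff_continuous (phi_diff phiv)).
  apply: cvgB; last exact: cvg_cst.
  apply: (@cvg_comp _ _ _ (fun w => v + w) h (nbhs w) (nbhs (v + w))).
    by apply: cvgD; [exact: cvg_cst|exact: cvg_id].
  exact: differentiable_continuous (phi_diff phivw).
have [|w0] := compact_EVT_min (f := fun w => bregman h (v + w) v) S0 (@compact_sphere R V e).
  by apply: continuous_in_subspaceT => w /set_mem; exact: bregman_cont.
rewrite inE/= => w0e minw0; exists (bregman h (v + w0) v / e).
  rewrite divr_gt0//; apply: mirror_bregman_gt0 => //.
    by apply: interior_subset; apply: phie; rewrite [v + _]addrC addrK.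
  by rewrite -subr_eq0 [v + _]addrC addrK -normr_eq0 w0e gt_eqF.
move=> u phiu eu.
have uv0 : 0 < `|u - v| by exact: lt_le_trans eu.
(* The segment from [v] to [u] crosses the sphere at parameter [s]. *)
set s := e / `|u - v|.
have s0 : 0 < s by rewrite divr_gt0.
have su : `|s *: (u - v)| = e by rewrite normrZ gtr0_norm// divfK// gt_eqF.
have := minw0 (s *: (u - v)); rewrite inE/= => /(_ su).
have -> : v + s *: (u - v) = s *: u + (1 - s) *: v.
  by rewrite scalerBr scalerBl scale1r addrCA.
move=> min_le; rewrite mulrAC ler_pdivrMr// -ler_pdivlMr// -mulrA [leRHS]mulrC -/s.
apply: le_trans min_le _.
have : s <= 1 by rewrite ler_pdivrMr// mul1r.
rewrite le_eqVlt => /predU1P[->|s1].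
  by rewrite subrr scale0r addr0 scale1r mul1r.
apply: bregmanZ.
by have [] := convex_fine phi_proper phi_convex phiu (interior_subset phiv) s0 s1.
Qed.

(** First-order expansion of the conjugate, including its finiteness nearby. The lower bound takes
    [u = v] in the supremum; the upper bound maximizes <m, u - v> - D(u, v). *)
Lemma conjugate_near_mirror v (e : R) : (edom phi)° v -> 0 < e ->
  \forall m \near (0 : dual V), exists2 c, conjugate phi (m + mirror phi v)%R = c%:E &
    0 <= c - (pairing (mirror phi v) v - h v) - pairing m v <= e * `|m|.
Proof.
move=> phiv e0; have [d d0 growth] := mirror_bregman_growth phiv e0.
near=> m.
have md : `|m| <= d by near: m; exact: nbhs0_le.
have phiv' := interior_subset phiv.
pose a : R := pairing (mirror phi v) v - h v + pairing m v.
have lo : (a%:E <= conjugate phi (m + mirror phi v)%R)%E.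
  apply: ereal_sup_ubound; exists v => //.
  rewrite (conjugate_bregman phi_proper _ phiv' phiv) addrK; congr EFin.
  by rewrite /bregman !subrr pairing0 !subr0.
have hi : (conjugate phi (m + mirror phi v)%R <= (a + e * `|m|)%:E)%E.
  apply: ge_ereal_sup => _ [u _ <-].
  have [phiu|] := ltP (phi u) +oo%E; last first.
    by rewrite leye_eq => /eqP ->; rewrite addeC/= leNye.
  rewrite (conjugate_bregman phi_proper _ phiu phiv) addrK lee_fin.
  have := pairing_le m (u - v); rewrite pairingD pairingN /a.
  have B0 := mirror_bregman_ge0 phi_proper phi_convex phi_diff phiu phiv.
  have m0 : 0 <= `|m| by [].
  (* Far from [v], the growth of slope [d] absorbs the linear term since |m| <= d; within distance
     [e], that term is at most e |m| and the divergence is nonnegative. *)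
  have [eu|ue] := leP e `|u - v|.
    have := growth u phiu eu.
    have : `|m| * `|u - v| <= d * `|u - v| by rewrite ler_wpM2r.
    have : 0 <= e * `|m| by rewrite mulr_ge0// ltW.
    lra.
  have : `|m| * `|u - v| <= e * `|m| by rewrite mulrC ler_wpM2r// ltW.
  lra.
(* The two real bounds exclude both infinite values. *)
move: lo hi; case: (conjugate _ _) => [c| |]//; rewrite !lee_fin => lo hi.
by exists c => //; move: lo hi; rewrite /a; lra.
Unshelve. all: by end_near. Qed.

Lemma conjugate_diff v : (edom phi)° v ->
  differentiable (fine \o conjugate phi) (mirror phi v) /\
  'd (fine \o conjugate phi) (mirror phi v) = evaluation v :> (dual V -> R).
Proof.
move=> phiv; apply: diff_from_bound; first exact: evaluation_continuous.
move=> e e0; apply: filterS (conjugate_near_mirror phiv e0) => m [c cE].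
rewrite /= cE (conjugate_mirror phi_proper phi_convex phi_diff phiv)/=.
by move=> /andP[c0 ce]; rewrite ger0_norm.
Qed.

(** The differential of the conjugate at [mirror phi v] is evaluation at [v], and [v] is determined
    by its evaluations. *)
Lemma mirrorK v : (edom phi)° v -> dual_mirror phi (mirror phi v) = v.
Proof.
move=> phiv; apply: pairing_inj => m.
by rewrite dual_gradE (conjugate_diff phiv).2.
Qed.

End conjugate_gradient.

(** * Calculus and a Gronwall estimate on the closed half-line *)

Section half_line_calculus.
Context {R : realType}.

(** Points just to the right of [t] belong to the half-line, even for t = 0. Properness makes limits
    of difference quotients unique. *)
Lemma half_line_proper (t : R) : 0 <= t -> ProperFilter (within `[0, +oo[ t^').
Proof.
move=> t0; apply: Build_ProperFilter_ex => A tA.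
apply: (@filter_ex _ t^'+); apply: (@filterS _ (nbhs t) _ _ _ _ tA) => s {}tA ts.
by apply: tA; rewrite /= ?gt_eqF// in_itv/= andbT (le_trans t0)// ltW.
Qed.

Lemma half_line_cvg_id (W : normedModType R) (u : R -> W) (t : R) (L : W) :
  diff_quotient u t s @[s --> within `[0, +oo[ t^'] --> L ->
  u s @[s --> within `[0, +oo[ t^'] --> u t.
Proof.
move=> uL.
have st : (s - t) @[s --> within `[0, +oo[ t^'] --> (0 : R).
  apply: cvg_trans (_ : (s - t) @[s --> t] --> 0).
    by apply: cvg_app; apply: cvg_trans (@nbhs_dnbhs _ t); exact: cvg_within.
  by rewrite -(subrr t); apply: cvgB; [exact: cvg_id|exact: cvg_cst].
have : (s - t) *: diff_quotient u t s + u t @[s --> within `[0, +oo[ t^'] --> u t.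
  rewrite -[X in _ --> X]add0r -(scale0r L).
  by apply: cvgD; [exact: cvgZ|exact: cvg_cst].
apply: cvg_trans; apply: near_eq_cvg; near=> s.
rewrite /diff_quotient scalerA divff ?scale1r ?subrK// subr_eq0.
by near: s; apply: (@cvg_within _ t^'); exact: (@nbhs_dnbhs_neq R).
Unshelve. all: by end_near. Qed.

(** The quotient of [F \o u] is the differential applied to the quotient of [u], plus a scaled
    remainder [rem] that tends to 0. *)
Lemma half_line_chain (U W : normedModType R) (F : U -> W) (u : R -> U) (t : R) (L : U) :
  diff_quotient u t s @[s --> within `[0, +oo[ t^'] --> L ->
  differentiable F (u t) ->
  diff_quotient (F \o u) t s @[s --> within `[0, +oo[ t^'] --> 'd F (u t) L.
Proof.
move=> uL dF; have ucvg := half_line_cvg_id uL.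
pose rem s := F (u s) - F (u t) - 'd F (u t) (u s - u t).
have rem0 : (s - t)^-1 *: rem s @[s --> within `[0, +oo[ t^'] --> 0.
  apply/cvgr0Pnorm_le => e e0.
  have M0 : 0 < `|L| + 1 by rewrite ltr_wpDl.
  (* The quotient of [u] is eventually bounded by |L| + 1, so this tolerance for the remainder of
     [F] yields [e] after division by s - t. *)
  have eM : 0 < e / (`|L| + 1) by rewrite divr_gt0.
  have u0 : (u s - u t) @[s --> within `[0, +oo[ t^'] --> 0.
    by rewrite -(subrr (u t)); apply: cvgB => //; exact: cvg_cst.
  have qle : \forall s \near within `[0, +oo[ t^', `|diff_quotient u t s| <= `|L| + 1.
    by apply: cvgr_norm_le uL _ _; rewrite ltrDl.
  have remle := u0 _ (diff_bound dF eM).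
  near=> s.
  have : `|rem s| <= e / (`|L| + 1) * `|u s - u t|.
    rewrite /rem -{1}(subrK (u t) (u s)).
    by near: s; exact: remle.
  have : `|diff_quotient u t s| <= `|L| + 1 by near: s; exact: qle.
  rewrite /diff_quotient !normrZ => qM remM.
  have st0 : 0 <= `|(s - t)^-1| by [].
  apply: le_trans (ler_wpM2l st0 remM) _.
  by rewrite mulrCA -ler_pdivlMl// invf_div divfK ?gt_eqF.
have : 'd F (u t) (diff_quotient u t s) + (s - t)^-1 *: rem s
    @[s --> within `[0, +oo[ t^'] --> 'd F (u t) L.
  rewrite -[X in _ --> X]addr0; apply: cvgD => //.
  apply: cvg_comp uL _; exact: diff_continuous.
apply: cvg_trans; apply: near_eq_cvg; near=> s.
by rewrite /diff_quotient /rem linearZ/= -scalerDr [X in _ *: X]addrC subrK.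
Unshelve. all: by end_near. Qed.

(** For t > 0 the half-line is a neighbourhood of [t], so the restriction does not change the
    limit. *)
Lemma half_line_is_derive (u : R -> R) (t L : R) : 0 < t ->
  diff_quotient u t s @[s --> within `[0, +oo[ t^'] --> L -> is_derive t 1 u L.
Proof.
move=> t0 uL.
have shift_t : (fun h : R => h + t) @ 0^' --> within `[0, +oo[ t^'.
  move=> A tA.
  have pos : \forall s \near t, 0 < s by exact: (lt_nbhsr t0).
  have {pos tA} : \forall s \near t, s != t -> A s.
    apply: filterS2 pos tA => s s0 sA st; apply: sA => //.
    by rewrite /= in_itv/= andbT ltW.
  rewrite (near_shift 0 t) subr0; apply: filterS => h /= hA h0; apply: hA.
  by rewrite -subr_eq0 addrK.
have {uL} uL : (fun h : R => h^-1 *: ((u \o shift t) (h *: 1) - u t)) @ 0^' --> L.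
  apply: cvg_trans (cvg_comp _ _ shift_t uL); apply: near_eq_cvg; near=> h.
  by rewrite /= /diff_quotient addrK /GRing.scale/= mulr1.
by split; [apply/cvg_ex; exists L | exact: cvg_lim].
Unshelve. all: by end_near. Qed.

(** The function exp(t) u(t) has nonpositive derivative for t > 0 and is continuous up to 0, hence
    is nonincreasing on the closed half-line. *)
Lemma half_line_gronwall (u D : R -> R) :
  (forall t : R, 0 <= t ->
    diff_quotient u t s @[s --> within `[0, +oo[ t^'] --> D t) ->
  (forall t : R, 0 <= t -> D t <= - u t) ->
  forall t : R, 0 <= t -> u t <= expR (- t) * u 0.
Proof.
move=> uD Du t t0.
pose F : R -> R := expR * u.
have dF (s : R) : 0 < s -> is_derive s 1 F (expR s *: D s + u s *: expR s).
  by move=> s0; have us := half_line_is_derive s0 (uD s (ltW s0)); exact: is_deriveM.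
suff : F t <= F 0.
  rewrite /F; change (expR t * u t <= expR 0 * u 0 -> u t <= expR (- t) * u 0).
  by rewrite expR0 mul1r expRN [_^-1 * _]mulrC ler_pdivlMr ?expR_gt0// mulrC.
apply: (@ler0_derive1_nincry _ F 0) => //.
- by move=> s; rewrite in_itv/= andbT => s0; have [] := dF s s0.
- move=> s; rewrite in_itv/= andbT => s0; rewrite derive1E; have [_ ->] := dF s s0.
  rewrite /GRing.scale/= [u s * _]mulrC -mulrDr mulr_ge0_le0 ?expR_ge0//.
  by rewrite -lerBrDr sub0r Du// ltW.
- rewrite continuous_subspace_in => s /set_mem; rewrite /= in_itv/= andbT => s0.
  have Fcvg : F x @[x --> within `[0, +oo[ (nbhs s)] --> F s.
    apply: cvgM; first by apply: cvg_within_filter; exact: continuous_expR.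
    apply/cvgrPdist_le => e e0.
    have /cvgrPdist_le/(_ e e0) us := half_line_cvg_id (uD s s0).
    apply: (@filterS _ (nbhs s) _ _ _ _ us) => x hx x0.
    (* The limit of [u] is taken over punctured neighbourhoods, so the point [s] itself is treated
       separately. *)
    have [->|xs] := eqVneq x s; last exact: hx.
    by rewrite subrr normr0 ltW.
  apply: cvg_trans Fcvg; apply: cvg_app.
  by rewrite /nbhs/= -nbhs_subspace_in//= in_itv/= andbT.
Qed.

End half_line_calculus.

(** * First-order optimality and linearity of the divergence *)

Lemma diff_minimizer (R : realType) (V : normedModType R) (f : V -> R) (x v : V) :
  differentiable f x -> (forall u, f x <= f u) -> 'd f x v = 0.
Proof.
move=> df fmin.
(* Nonnegativity in the directions [v] and [- v] forces a linear form to vanish there. *)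
suff ge0 w : 0 <= 'd f x w.
  by apply/eqP; rewrite eq_le ge0 andbT -oppr_ge0 -linearN ge0.
rewrite -deriveE//.
have der : (fun t : R => t^-1 *: ((f \o shift x) (t *: w) - f x)) @ 0^'+ -->
    'D_w f x.
  by apply: cvg_dnbhs_at_right; exact: diff_derivable.
apply: (@closed_cvg R R _ _ _ (fun a => 0 <= a) _ _ _ der).
  exact: closed_ge.
near=> t => /=.
have t0 : 0 < t by near: t; exact: nbhs_right_gt.
by rewrite mulr_ge0 ?invr_ge0 ?(ltW t0)// subr_ge0.
Unshelve. all: by end_near. Qed.

Lemma bregman_subZ (R : realType) (V : finHilbertType R) (f1 f2 : V -> R) (a : R) u v :
  differentiable f1 v -> differentiable f2 v ->
  bregman (fun w => f1 w - a * f2 w) u v = bregman f1 u v - a * bregman f2 u v.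
Proof.
move=> /differentiableP df1 /differentiableP df2.
have df : is_diff v (f1 - a *: f2) (('d f1 v : V -> R) - a *: ('d f2 v : V -> R)).
  exact: is_diffB.
have gradf : pairing (grad (fun w => f1 w - a * f2 w) v) (u - v) =
    pairing (grad f1 v) (u - v) - a * pairing (grad f2 v) (u - v).
  transitivity ('d (f1 - a *: f2) v (u - v)); first exact: gradE.
  transitivity ('d f1 v (u - v) - a * 'd f2 v (u - v)).
    by have /(congr1 (fun F => F (u - v))) := @diff_val _ _ _ _ _ _ _ df.
  by congr (_ - a * _); exact/esym/gradE.
(* Over variables because comparing gradients of distinct functions up to
   conversion is prohibitively slow. *)
have alg (u1 u2 v1 v2 p1 p2 p : R) : p = p1 - a * p2 ->
    u1 - a * u2 - (v1 - a * v2) - p = u1 - v1 - p1 - a * (u2 - v2 - p2).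
  by move=> ->; ring.
exact: alg.
Qed.

(** * The energy in mirror coordinates and its differential *)

Section energy.
Context {R : realType} {V : finHilbertType R}.
Variables (f : V -> R) (phi : V -> \bar R) (mu : R) (xstar : V).
Hypothesis f_diff : forall v, differentiable f v.
Hypothesis xstar_min : forall v, f xstar <= f v.
Hypothesis phi_legendre : legendre phi.

Let phi_proper : Defs.proper phi. Proof. by case: phi_legendre. Qed.
Let phi_convex : strictly_convex phi. Proof. by case: phi_legendre. Qed.
Let phi_diff v : (edom phi)° v -> differentiable (fine \o phi) v.
Proof. by case: phi_legendre => _ _ _ + _; apply. Qed.
Let mirror_bij : set_bij (edom phi)° (edom (conjugate phi))° (mirror phi).
Proof. by case: phi_legendre. Qed.

Local Notation h := (fine \o phi).
Local Notation E := (energy f phi mu xstar).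
Local Notation Ec := (energy_coord f phi mu xstar).
Local Notation g := (fun v => f v - mu * fine (phi v)).

Lemma mirror_int v : (edom phi)° v -> (edom (conjugate phi))° (mirror phi v).
Proof. by have [+ _ _] := mirror_bij => mirror_fun; exact: mirror_fun. Qed.

Lemma mirror_surj l : (edom (conjugate phi))° l ->
  exists2 v, (edom phi)° v & mirror phi v = l.
Proof. by have [_ _ +] := mirror_bij => surj /surj[v phiv vl]; exists v. Qed.

Lemma bregman_minimizer u : bregman f u xstar = f u - f xstar.
Proof. by rewrite /bregman gradE diff_minimizer// subr0. Qed.

(* Fenchel's equality phi (y) + phi^* (eta) = <eta, y> at y = grad phi^* (eta). *)
Lemma energy_coordE x eta : (edom (conjugate phi))° eta ->
  Ec (x, eta) = f x - f xstar +
    mu * (h xstar + (fine \o conjugate phi) eta - pairing eta xstar).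
Proof.
move=> /mirror_surj[w phiw <-]; rewrite /energy_coord /energy/=.
rewrite bregman_minimizer (mirrorK phi_proper phi_convex phi_diff)//.
rewrite (conjugate_mirror phi_proper phi_convex phi_diff)//=.
by rewrite /bregman /mirror pairingD pairingN/=; lra.
Qed.

Lemma energy_mirror x y : (edom phi)° y -> E (x, y) = Ec (x, mirror phi y).
Proof.
by move=> phiy; rewrite /energy_coord/= (mirrorK phi_proper phi_convex phi_diff).
Qed.

(** In the Fenchel form of the energy, x and eta separate, and the conjugate has gradient [y] at
    [mirror phi y]; the partial gradient in eta is thus mu (y - xstar). *)
Lemma energy_coord_diff x y : (edom phi)° y ->
  differentiable Ec (x, mirror phi y) /\
  forall a b, 'd Ec (x, mirror phi y) (a, b) =
    'd f x a + mu * (pairing b y - pairing b xstar).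
Proof.
move=> phiy; set eta := mirror phi y.
pose G (q : V * dual V) := f q.1 - f xstar +
  mu * (h xstar + (fine \o conjugate phi) q.2 - pairing q.2 xstar).
have EcG : \forall q \near (x, eta), Ec q = G q.
  have : nbhs eta (edom (conjugate phi))°.
    by apply: nbhs_interior; exact: mirror_int.
  move=> /(@cvg_snd _ _ (nbhs x)) near_int.
  apply: (@filterS _ (nbhs (x, eta)) _ _ _ _ near_int) => -[u l] /= ul.
  exact: energy_coordE.
have dfst : is_diff (x, eta) (fst : V * dual V -> V) fst.
  have fst_cont : continuous (fst : V * dual V -> V) by move=> ?; exact: cvg_fst.
  by apply: DiffDef; [exact: linear_differentiable|exact: diff_lin].
have dsnd : is_diff (x, eta) (snd : V * dual V -> dual V) snd.
  have snd_cont : continuous (snd : V * dual V -> dual V) by move=> ?; exact: cvg_snd.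
  by apply: DiffDef; [exact: linear_differentiable|exact: diff_lin].
have df : is_diff x f ('d f x) by exact: differentiableP.
have dconj : is_diff eta (fine \o conjugate phi) (evaluation y).
  have [? ?] := conjugate_diff phi_proper phi_convex phi_diff phiy.
  exact: DiffDef.
have dev : is_diff eta (evaluation xstar : dual V -> R) (evaluation xstar).
  apply: DiffDef; first by apply: linear_differentiable; exact: evaluation_continuous.
  by apply: diff_lin; exact: evaluation_continuous.
(* The two zeros are the differentials of the constants [f xstar] and [h xstar]. *)
have dG : is_diff (x, eta) G (('d f x \o fst) - 0 + mu *: (0
    + ((evaluation y : dual V -> R) \o snd)
    - ((evaluation xstar : dual V -> R) \o snd))).
  have -> : G = (f \o fst) - cst (f xstar) + mu *: (cst (h xstar)
      + ((fine \o conjugate phi) \o snd)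
      - ((evaluation xstar : dual V -> R) \o snd)) by [].
  have dfx := is_diff_comp dfst df.
  have dconjy := is_diff_comp dsnd dconj.
  have devx := is_diff_comp dsnd dev.
  exact: is_diffD (is_diffB dfx (is_diff_cst _ _))
    (is_diffZ mu (is_diffB (is_diffD (is_diff_cst _ _) dconjy) devx)).
have [dEc dEcE] := near_diff EcG (ex_diff (is_diff_def := dG)).
split=> // a b; rewrite dEcE diff_val.
rewrite -[LHS]/('d f x a - 0 + mu * (0 + pairing b y - pairing b xstar)).
by rewrite subr0 add0r.
Qed.

Lemma energy_diff_flow (beta : R) x y : mu != 0 -> (edom phi)° x -> (edom phi)° y ->
  'd Ec (x, mirror phi y)
    (y - x - beta *: dual_mirror phi (grad f x),
     mirror phi x - mirror phi y - mu^-1 *: grad f x) =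
  - E (x, y) - beta * pairing (grad f x) (dual_mirror phi (grad f x))
  - bregman g xstar x - mu * bregman h y x.
Proof.
move=> mu0 phix phiy; rewrite (energy_coord_diff x phiy).2.
have -> : bregman g xstar x = bregman f xstar x - mu * bregman h xstar x.
  by apply: bregman_subZ => //; exact: phi_diff.
rewrite /energy [_.1]/= [_.2]/= bregman_minimizer -gradE.
rewrite /bregman /mirror.
(* Once the flow is substituted, the identity is pure bilinear algebra: it holds for arbitrary
   covectors and reals in place of the gradients and function values, with [mu] nonzero to cancel
   its inverse. *)
have alg (l mx my : dual V) (w : V) (fx fs hx hy hs : R) :
  pairing l (y - x - beta *: w) + mu * (pairing (mx - my - mu^-1 *: l) y
    - pairing (mx - my - mu^-1 *: l) xstar) =
  - (fx - fs + mu * (hs - hy - pairing my (xstar - y))) - beta * pairing l w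
  - (fs - fx - pairing l (xstar - x) - mu * (hs - hx - pairing mx (xstar - x)))
  - mu * (hy - hx - pairing mx (y - x)).
  rewrite !(pairingD, pairingN, pairingZ) !(pairingDl, pairingNl, pairingZl).
  by field.
exact: alg.
Qed.

End energy.

(** * Dissipation along the flow and exponential decay *)

Theorem lemma3p1 (R : realType) (V : finHilbertType R)
  (f : V -> R) (phi : V -> \bar R) (xstar : V) (mu beta : R) (x y : R -> V)
  (f_diff : forall v, differentiable f v)
  (f_C1 : continuous (grad f : V -> dual V))
  (xstar_min : forall v, f xstar <= f v)
  (phi_legendre : legendre phi)
  (xstar_int : (edom phi)° xstar)
  (int0 : (edom phi)° 0)
  (mirror0 : mirror phi 0 = 0)
  (dual_int0 : (edom (conjugate phi))° 0)
  (dual_mirror0 : dual_mirror phi 0 = 0)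
  (mu_gt0 : 0 < mu) (beta_gt0 : 0 < beta)
  (sol : flow_solution f phi mu beta x y) :
  let E := energy f phi mu xstar in
  let Ec := energy_coord f phi mu xstar in
  let g := fun v => f v - mu * fine (phi v) in
  (forall t, 0 <= t ->
    let p := (x t, mirror phi (y t)) in
    let dp := (half_line_derive x t, half_line_derive (mirror phi \o y) t) in
    [/\ differentiable Ec p,
        half_line_derivable (fun s => E (x s, y s)) t,
        half_line_derive (fun s => E (x s, y s)) t = 'd Ec p dp
      & 'd Ec p dp =
          - E (x t, y t)
          - beta * pairing (grad f (x t)) (dual_mirror phi (grad f (x t)))
          - bregman g xstar (x t)
          - mu * bregman (fine \o phi) (y t) (x t)]) /\
  (convex_function (edom phi) g ->
    forall t, 0 <= t -> E (x t, y t) <= expR (- t) * E (x 0, y 0)).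
Proof.
move=> E Ec g.
have [phi_proper _ phi_convex phi_diff _] := phi_legendre.
have E_cvg t : 0 <= t ->
    diff_quotient (fun s => E (x s, y s)) t s @[s --> within `[0, +oo[ t^'] -->
    'd Ec (x t, mirror phi (y t))
      (half_line_derive x t, half_line_derive (mirror phi \o y) t).
  move=> t0; have [[_ phiy _] x_cvg _ eta_cvg _] := sol t t0.
  have [dEc _] := energy_coord_diff mu f_diff xstar_min phi_legendre (x t) phiy.
  have p_cvg : diff_quotient (fun s => (x s, mirror phi (y s))) t s
      @[s --> within `[0, +oo[ t^'] -->
      (half_line_derive x t, half_line_derive (mirror phi \o y) t).
    exact: cvg_pair x_cvg eta_cvg.
  (* The energy agrees with its coordinate form where y lies in the interior of the domain, which
     the flow guarantees for s >= 0; the half-line filter sees only such s. *)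
  apply: cvg_trans (half_line_chain p_cvg dEc); apply: near_eq_cvg.
  have : \forall s \near within `[0, +oo[ t^', `[0, +oo[%classic s.
    exact: withinT.
  apply: filterS => s; rewrite /= in_itv/= andbT => s0.
  have [[_ phiys _] _ _ _ _] := sol s s0.
  rewrite /diff_quotient /= -(energy_mirror f mu xstar phi_legendre (x t) phiy).
  by rewrite -(energy_mirror f mu xstar phi_legendre (x s) phiys).
have dissipation t : 0 <= t -> 'd Ec (x t, mirror phi (y t))
      (half_line_derive x t, half_line_derive (mirror phi \o y) t) =
    - E (x t, y t) - beta * pairing (grad f (x t)) (dual_mirror phi (grad f (x t)))
    - bregman g xstar (x t) - mu * bregman (fine \o phi) (y t) (x t).
  move=> t0; have [[phix phiy _] _ -> _ ->] := sol t t0.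
  by apply: energy_diff_flow => //; rewrite gt_eqF.
split=> [t t0 p dp|g_convex t t0].
  have [[_ phiy _] _ _ _ _] := sol t t0.
  have [dEc _] := energy_coord_diff mu f_diff xstar_min phi_legendre (x t) phiy.
  split=> //; [|have Fproper := half_line_proper t0|exact: dissipation].
  - by apply/cvg_ex; eexists; exact: E_cvg.
  - by apply: cvg_lim (E_cvg t t0); exact: norm_hausdorff.
apply: (half_line_gronwall E_cvg) t0 => {}t t0; rewrite dissipation//.
have [[phix phiy dual_int] _ _ _ _] := sol t t0.
have Dphi_ge0 := mirror_bregman_ge0 phi_proper phi_convex phi_diff
  (interior_subset phiy) phix.
have Dg_ge0 : 0 <= bregman g xstar (x t).
  apply: bregman_ge0 => [|s s0 s1].
    by apply: differentiableB; [exact: f_diff|apply: differentiableZ; exact: phi_diff].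
  have := g_convex (Itv01 (ltW s0) (ltW s1)) xstar (x t).
  by rewrite !inE => /(_ (interior_subset xstar_int) (interior_subset phix)).
have friction_ge0 : 0 <= pairing (grad f (x t)) (dual_mirror phi (grad f (x t))).
  (* Writing grad f (x t) as [mirror phi v] turns the pairing into <mirror v - mirror 0, v - 0>,
     which is nonnegative by monotonicity. *)
  have [v phiv <-] := mirror_surj phi_legendre dual_int.
  rewrite (mirrorK phi_proper phi_convex phi_diff)//.
  have := mirror_monotone phi_proper phi_convex phi_diff phiv int0.
  by rewrite mirror0 !subr0.
rewrite -!addrA gerDl -!opprD oppr_le0.
apply: addr_ge0; first exact: mulr_ge0 (ltW beta_gt0) friction_ge0.
by apply: addr_ge0 Dg_ge0 _; exact: mulr_ge0 (ltW mu_gt0) Dphi_ge0.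
Qed.
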